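(* Let $D\in\mathcal D$ be a definite formula and $G\in\mathcal G$ a goal formula, and let $x$ be an object variable such that $\mathsf{MA}^\omega\vdash D\to\forall_x(G\to\bot)\to\bot$. Then $\mathsf{HA}^\omega\vdash D^{\mathbf F}\to\exists_xG^{\mathbf F}$.
   Context: **Types.** Generated from countably many type variables $\xi$ by $\tau,\rho::=\xi\mid\mathbb B\mid\mathbb N\mid\mathbb L(\tau)\mid\tau\to\rho\mid\tau\times\rho$ (booleans, natural numbers, lists, functions, pairs). **Terms.** Simply typed terms built by application and $\lambda$-abstraction from typed object variables (countably many for each type), the constructors $\langle\cdot,\cdot\rangle:\tau\to\rho\to\tau\times\rho$; $\mathsf{tt},\mathsf{ff}:\mathbb B$; $0:\mathbb N$; $\mathsf S:\mathbb N\to\mathbb N$; $\mathsf{nil}_\tau:\mathbb L(\tau)$; $\cdot::_\tau\cdot:\tau\to\mathbb L(\tau)\to\mathbb L(\tau)$, and the destructors $\mathsf{split}:\rho\times\sigma\to(\rho\to\sigma\to\tau)\to\tau$; $\mathsf{Cases}:\mathbb B\to\tau\to\tau\to\tau$; $\mathcal R_{\mathbb N}:\mathbb N\to\tau\to(\mathbb N\to\tau\to\tau)\to\tau$; $\mathcal R_{\mathbb L(\rho)}:\mathbb L(\rho)\to\tau\to(\rho\to\mathbb L(\rho)\to\tau\to\tau)\to\tau$ (for all types $\rho,\sigma,\tau$). The usual conversion rules hold: $(\lambda_x t(x))s\mapsto t(s)$, $\mathsf{split}\langle t,s\rangle f\mapsto f\,t\,s$, $\mathsf{Cases}\,\mathsf{tt}\,t\,s\mapsto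 t$, $\mathsf{Cases}\,\mathsf{ff}\,t\,s\mapsto s$, $\mathcal R_{\mathbb N}\,0\,a\,f\mapsto a$, $\mathcal R_{\mathbb N}(\mathsf Sn)\,a\,f\mapsto f\,n(\mathcal R_{\mathbb N}\,n\,a\,f)$, $\mathcal R_{\mathbb L(\rho)}\,\mathsf{nil}\,a\,f\mapsto a$, $\mathcal R_{\mathbb L(\rho)}(x::l)\,a\,f\mapsto f\,x\,l(\mathcal R_{\mathbb L(\rho)}\,l\,a\,f)$; a proof of a formula also counts as a proof of any formula obtained from it by converting terms inside it. Bound variables may be renamed, and substitution is capture-avoiding. **Formulas.** Formulas of $\mathsf{MA}^\omega$: atomic formulas $\mathsf{at}(t)$ for terms $t:\mathbb B$ and the symbol $\bot$, closed under $A\to B$, $A\wedge B$, $\forall_xA$ ($x$ an object variable of any type). Formulas of $\mathsf{HA}^\omega$: atomic formulas $\mathsf{at}(t)$ (no $\bot$), closed under $\to,\wedge,\vee,\forall_x,\exists_x$. $\mathsf{Form}_{\mathsf{XA}^\omega}$ is the set of formulas of $\mathsf{XA}^\omega$. Abbreviations: $\mathbf T:=\mathsf{at}(\mathsf{tt})$, $\mathbf F:=\mathsf{at}(\mathsf{ff})$, $\neg A:=A\to\mathbf F$. Implication associates to the right. **Substitution for $\bot$.** $A^S$ is the result of replacing $\bot$ by the formula $S$ in $A$: $\bot^S:=S$, $\mathsf{at}(t)^S:=\mathsf{at}(t)$, $(A\circ B)^S:=A^S\circ B^S$ for $\circ\in\{\wedge,\to\}$, $(\forall_xA)^S:=\forall_xA^S$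 (renaming $x$ if necessary to avoid capture). **Proofs.** Natural deduction with assumption variables: introduction and elimination rules for $\to$, $\wedge$, $\forall$ (for $\forall$-introduction, $x$ must not be free in any open assumption). Common axioms (for all formulas $A$ of the system): $\mathbf T$; $\forall_b(A(\mathsf{tt})\to A(\mathsf{ff})\to A(b))$ with $b:\mathbb B$; $\forall_n(A(0)\to\forall_n(A(n)\to A(\mathsf Sn))\to A(n))$; $\forall_l(A(\mathsf{nil})\to\forall_{x,l}(A(l)\to A(x::l))\to A(l))$. $\mathsf{MA}^\omega$ has in addition the axiom $\bot^+:\mathbf F\to\bot$. $\mathsf{HA}^\omega$ has in addition to the common axioms: $A\to A\vee B$; $B\to A\vee B$; $A\vee B\to(A\to C)\to(B\to C)\to C$; $A(t)\to\exists_xA(x)$; $\exists_xA\to\forall_x(A\to C)\to C$ ($x$ not free in $C$). $\mathsf{XA}^\omega\vdash A$ means that there is a proof of $A$ in $\mathsf{XA}^\omega$ without free assumptions. **Formula classes.** $\mathcal P:=\{\mathsf{at}(t)\mid t \text{ a term},\ t:\mathbb B\}$. The set $\mathcal Q$ is defined by recursion: $\mathcal P\subseteq\mathcal Q$; $\bot\notin\mathcal Q$; $A\to B\in\mathcal Q$ iff $A,B\in\mathcal Q$; $A\wedge B\in\mathcal Q$ iff $A,B\in\mathcal Q$; $\forall_xA(x)\in\mathcal Q$ iff $x:\mathbb B$ and $A(\mathsf{tt}),A(\mathsf{ff})\in\mathcal Q$. Let $\mathcal Q_{\mathbf F}:=\{A\in\mathsf{Form}_{\mathsf{MA}^\omega}\mid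 A^{\mathbf F}\in\mathcal Q\}$. The sets $\mathcal D$ (definite), $\mathcal G$ (goal), $\mathcal R$ (relevant), $\mathcal I$ (irrelevant) of formulas of $\mathsf{MA}^\omega$ are defined simultaneously by recursion on the formula structure: - $\bot\in\mathcal D\cap\mathcal R\cap\mathcal G$, $\bot\notin\mathcal I$; $\mathcal P\subseteq\mathcal D\cap\mathcal I\cap\mathcal G$, $\mathcal P\cap\mathcal R=\{\mathbf T\}$. - $A\to B\in\mathcal D$ iff ($A\in\mathcal I$ and $B\in\mathcal D$) or ($A\in\mathcal G$ and $B\in\mathcal R$). - $A\to B\in\mathcal G$ iff ($A\in\mathcal R\cup(\mathcal D\cap\mathcal Q_{\mathbf F})$ and $B\in\mathcal G$) or ($A\in\mathcal D$ and $B\in\mathcal I$). - $A\to B\in\mathcal R$ iff $A\in\mathcal G$ and $B\in\mathcal R$. - $A\to B\in\mathcal I$ iff $A\in\mathcal D$ and $B\in\mathcal I$. - $A\wedge B\in\mathcal S$ iff $A,B\in\mathcal S$, for each $\mathcal S\in\{\mathcal D,\mathcal G,\mathcal R,\mathcal I\}$. - $\forall_xA(x)\in\mathcal D$ iff $A\in\mathcal D\cup\mathcal R$; $\forall_xA(x)\in\mathcal G$ iff $A\in\mathcal I$, or $x:\mathbb B$ and $A(\mathsf{tt}),A(\mathsf{ff})\in\mathcal G$; $\forall_xA(x)\in\mathcal R$ iff $A\in\mathcal R$; $\forall_xA(x)\in\mathcal I$ iff $A\in\mathcal I$. *)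

(* Defs.v *)
From Stdlib Require Import List.
Import ListNotations.

Set Implicit Arguments.
Unset Strict Implicit.
Unset Printing Implicit Defensive.

Inductive ty : Type :=
| TVar : nat -> ty
| Bool : ty
| Nat : ty
| TList : ty -> ty
| Arr : ty -> ty -> ty
| Prod : ty -> ty -> ty.

Declare Scope ty_scope.
Delimit Scope ty_scope with ty.
Bind Scope ty_scope with ty.
Infix "⇒" := Arr (at level 60, right associativity) : ty_scope.
Infix "×" := Prod (at level 50, left associativity) : ty_scope.

Definition ty_eq_dec (r t : ty) : {r = t} + {r <> t}.
Proof. decide equality; apply PeanoNat.Nat.eq_dec. Defined.

Inductive const : ty -> Type :=
| Pair (r s : ty) : const (r ⇒ s ⇒ r × s)
| TT : const Bool
| FF : const Bool
| Zero : const Nat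
| Succ : const (Nat ⇒ Nat)
| Nil (r : ty) : const (TList r)
| Cons (r : ty) : const (r ⇒ TList r ⇒ TList r)
| Split (r s t : ty) : const (r × s ⇒ (r ⇒ s ⇒ t) ⇒ t)
| Cases (t : ty) : const (Bool ⇒ t ⇒ t ⇒ t)
| RecN (t : ty) : const (Nat ⇒ t ⇒ (Nat ⇒ t ⇒ t) ⇒ t)
| RecL (r t : ty) : const (TList r ⇒ t ⇒ (r ⇒ TList r ⇒ t ⇒ t) ⇒ t).

(* De Bruijn indices are counted separately for each type: a binder for a
   variable of type [r] binds [Var r 0] in its scope, where [Var r (S n)]
   denotes the outer [Var r n] and [Var t n] with [t <> r] is unaffected.
   Hence an open term has countably many free variables of every type at its
   disposal (so every type is inhabited by an open term), no typing contexts
   are needed, and terms are equal iff they are alpha-equivalent. *)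
Inductive term : ty -> Type :=
| Var (t : ty) : nat -> term t
| Con (t : ty) : const t -> term t
| App (r t : ty) : term (r ⇒ t) -> term r -> term t
| Lam (r t : ty) : term t -> term (r ⇒ t).

Arguments Var : clear implicits.
Arguments Lam r {t} b.

Definition renaming : Type := ty -> nat -> nat.
Definition substitution : Type := forall t : ty, nat -> term t.

Definition shift (r : ty) : renaming := fun t n =>
  if ty_eq_dec r t then S n else n.

Definition up_ren (r : ty) (f : renaming) : renaming := fun t n =>
  if ty_eq_dec r t then
    match n with 0 => 0 | S m => S (f t m) end
  else f t n.

Fixpoint ren_tm (f : renaming) (t : ty) (u : term t) : term t :=
  match u with
  | Var t n => Var t (f t n)
  | Con c => Con c
  | App u v => App (ren_tm f u) (ren_tm f v)
  | Lam r b => Lam r (ren_tm (up_ren r f) b)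
  end.

Definition up_sub (r : ty) (s : substitution) : substitution := fun t n =>
  if ty_eq_dec r t then
    match n with 0 => Var t 0 | S m => ren_tm (shift r) (s t m) end
  else ren_tm (shift r) (s t n).

Fixpoint sub_tm (s : substitution) (t : ty) (u : term t) : term t :=
  match u with
  | Var t n => s t n
  | Con c => Con c
  | App u v => App (sub_tm s u) (sub_tm s v)
  | Lam r b => Lam r (sub_tm (up_sub r s) b)
  end.

(* [inst v] replaces the variable [Var r 0] bound by a discarded binder. *)
Definition inst (r : ty) (v : term r) : substitution := fun t n =>
  match ty_eq_dec r t with
  | left e =>
      match n with 0 => eq_rect r term v t e | S m => Var t m end
  | right _ => Var t n
  end.

(* [repl v] replaces [Var r 0] without discarding a binder: [v] may itself
   contain [Var r 0], and all other variables are left alone. *)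
Definition repl (r : ty) (v : term r) : substitution := fun t n =>
  match ty_eq_dec r t with
  | left e =>
      match n with 0 => eq_rect r term v t e | S m => Var t (S m) end
  | right _ => Var t n
  end.

Definition tt_tm : term Bool := Con TT.
Definition ff_tm : term Bool := Con FF.
Definition zero_tm : term Nat := Con Zero.
Definition succ_tm (n : term Nat) : term Nat := App (Con Succ) n.
Definition nil_tm (r : ty) : term (TList r) := Con (Nil r).
Definition cons_tm (r : ty) (x : term r) (l : term (TList r)) : term (TList r) :=
  App (App (Con (Cons r)) x) l.
Definition pair_tm (r s : ty) (u : term r) (v : term s) : term (r × s) :=
  App (App (Con (Pair r s)) u) v.
Definition split_tm (r s t : ty) (p : term (r × s)) (f : term (r ⇒ s ⇒ t))
  : term t := App (App (Con (Split r s t)) p) f.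
Definition cases_tm (t : ty) (b : term Bool) (u v : term t) : term t :=
  App (App (App (Con (Cases t)) b) u) v.
Definition recN_tm (t : ty) (n : term Nat) (a : term t)
  (f : term (Nat ⇒ t ⇒ t)) : term t := App (App (App (Con (RecN t)) n) a) f.
Definition recL_tm (r t : ty) (l : term (TList r)) (a : term t)
  (f : term (r ⇒ TList r ⇒ t ⇒ t)) : term t :=
  App (App (App (Con (RecL r t)) l) a) f.

Inductive conv : forall t : ty, term t -> term t -> Prop :=
| conv_beta r t (b : term t) (v : term r) :
    conv (App (Lam r b) v) (sub_tm (inst v) b)
| conv_split r s t (u : term r) (v : term s) (f : term (r ⇒ s ⇒ t)) :
    conv (split_tm (pair_tm u v) f) (App (App f u) v)
| conv_cases_tt t (u v : term t) : conv (cases_tm tt_tm u v) u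
| conv_cases_ff t (u v : term t) : conv (cases_tm ff_tm u v) v
| conv_recN_zero t (a : term t) f : conv (recN_tm zero_tm a f) a
| conv_recN_succ t n (a : term t) f :
    conv (recN_tm (succ_tm n) a f) (App (App f n) (recN_tm n a f))
| conv_recL_nil r t (a : term t) f : conv (recL_tm (nil_tm r) a f) a
| conv_recL_cons r t (x : term r) l (a : term t) f :
    conv (recL_tm (cons_tm x l) a f)
         (App (App (App f x) l) (recL_tm l a f))
| conv_app r t (u u' : term (r ⇒ t)) (v v' : term r) :
    conv u u' -> conv v v' -> conv (App u v) (App u' v')
| conv_lam r t (b b' : term t) : conv b b' -> conv (Lam r b) (Lam r b')
| conv_refl t (u : term t) : conv u u
| conv_sym t (u v : term t) : conv u v -> conv v u
| conv_trans t (u v w : term t) : conv u v -> conv v w -> conv u w.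

(* The formulas of both systems live in one type; [is_form] singles out those
   of each system. *)
Inductive form : Type :=
| At : term Bool -> form
| Bot : form
| Imp : form -> form -> form
| And : form -> form -> form
| Or : form -> form -> form
| All : ty -> form -> form
| Ex : ty -> form -> form.

Declare Scope form_scope.
Delimit Scope form_scope with form.
Bind Scope form_scope with form.
Infix "⊃" := Imp (at level 60, right associativity) : form_scope.
Infix "⋀" := And (at level 50, left associativity) : form_scope.
Infix "⋁" := Or (at level 50, left associativity) : form_scope.
Open Scope form_scope.

Definition Tr : form := At tt_tm.
Definition Fa : form := At ff_tm.
Definition Neg (A : form) : form := A ⊃ Fa.

Inductive system : Type := MA | HA.

Fixpoint is_form (X : system) (A : form) : Prop :=
  match A with
  | At _ => True
  | Bot => X = MA
  | A ⊃ B | A ⋀ B => is_form X A /\ is_form X B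
  | A ⋁ B => X = HA /\ is_form X A /\ is_form X B
  | All _ A => is_form X A
  | Ex _ A => X = HA /\ is_form X A
  end.

Fixpoint ren (f : renaming) (A : form) : form :=
  match A with
  | At t => At (ren_tm f t)
  | Bot => Bot
  | A ⊃ B => ren f A ⊃ ren f B
  | A ⋀ B => ren f A ⋀ ren f B
  | A ⋁ B => ren f A ⋁ ren f B
  | All r A => All r (ren (up_ren r f) A)
  | Ex r A => Ex r (ren (up_ren r f) A)
  end.

Fixpoint sub (s : substitution) (A : form) : form :=
  match A with
  | At t => At (sub_tm s t)
  | Bot => Bot
  | A ⊃ B => sub s A ⊃ sub s B
  | A ⋀ B => sub s A ⋀ sub s B
  | A ⋁ B => sub s A ⋁ sub s B
  | All r A => All r (sub (up_sub r s) A)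
  | Ex r A => Ex r (sub (up_sub r s) A)
  end.

(* [A] moved under a binder of type [r] whose variable is not free in [A]. *)
Definition lift (r : ty) (A : form) : form := ren (shift r) A.

Inductive fconv : form -> form -> Prop :=
| fconv_at t t' : conv t t' -> fconv (At t) (At t')
| fconv_bot : fconv Bot Bot
| fconv_imp A A' B B' : fconv A A' -> fconv B B' -> fconv (A ⊃ B) (A' ⊃ B')
| fconv_and A A' B B' : fconv A A' -> fconv B B' -> fconv (A ⋀ B) (A' ⋀ B')
| fconv_or A A' B B' : fconv A A' -> fconv B B' -> fconv (A ⋁ B) (A' ⋁ B')
| fconv_all r A A' : fconv A A' -> fconv (All r A) (All r A')
| fconv_ex r A A' : fconv A A' -> fconv (Ex r A) (Ex r A').

(* The formula [A^S]. *)
Fixpoint bot_sub (S A : form) : form :=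
  match A with
  | At t => At t
  | Bot => S
  | A ⊃ B => bot_sub S A ⊃ bot_sub S B
  | A ⋀ B => bot_sub S A ⋀ bot_sub S B
  | A ⋁ B => bot_sub S A ⋁ bot_sub S B
  | All r A => All r (bot_sub (lift r S) A)
  | Ex r A => Ex r (bot_sub (lift r S) A)
  end.

(* In the induction axioms the induction variable is the index 0 of its type
   in [A]; the premises do not contain the outermost quantified variable,
   whence the [lift]s. *)
Inductive axiom : system -> form -> Prop :=
| ax_true X : axiom X Tr
| ax_bool X A : is_form X A ->
    axiom X (All Bool (lift Bool (sub (inst tt_tm) A) ⊃
                       lift Bool (sub (inst ff_tm) A) ⊃ A))
| ax_nat X A : is_form X A ->
    axiom X (All Nat
      (lift Nat (sub (inst zero_tm) A) ⊃
       lift Nat (All Nat (A ⊃ sub (repl (succ_tm (Var Nat 0))) A)) ⊃ A))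
| ax_list X r A : is_form X A ->
    (* [A(l)] under the two binders [x : r] and [l : TList r] *)
    let Al := ren (up_ren (TList r) (shift r)) A in
    axiom X (All (TList r)
      (lift (TList r) (sub (inst (nil_tm r)) A) ⊃
       lift (TList r)
         (All r (All (TList r)
           (Al ⊃ sub (repl (cons_tm (Var r 0) (Var (TList r) 0))) Al))) ⊃ A))
| ax_bot : axiom MA (Fa ⊃ Bot)
| ax_or_introl A B : is_form HA A -> is_form HA B -> axiom HA (A ⊃ A ⋁ B)
| ax_or_intror A B : is_form HA A -> is_form HA B -> axiom HA (B ⊃ A ⋁ B)
| ax_or_elim A B C : is_form HA A -> is_form HA B -> is_form HA C ->
    axiom HA (A ⋁ B ⊃ (A ⊃ C) ⊃ (B ⊃ C) ⊃ C)
| ax_ex_intro r A (t : term r) : is_form HA A ->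
    axiom HA (sub (inst t) A ⊃ Ex r A)
| ax_ex_elim r A C : is_form HA A -> is_form HA C ->
    axiom HA (Ex r A ⊃ All r (A ⊃ lift r C) ⊃ C).

(* Derivability from the open assumptions [Gamma]. The [is_form] premises
   ensure that a derivation only contains formulas of the system. *)
Inductive nd (X : system) : list form -> form -> Prop :=
| nd_assume Gamma A : is_form X A -> In A Gamma -> nd X Gamma A
| nd_axiom Gamma A : axiom X A -> nd X Gamma A
| nd_imp_intro Gamma A B :
    is_form X A -> nd X (A :: Gamma) B -> nd X Gamma (A ⊃ B)
| nd_imp_elim Gamma A B : nd X Gamma (A ⊃ B) -> nd X Gamma A -> nd X Gamma B
| nd_and_intro Gamma A B : nd X Gamma A -> nd X Gamma B -> nd X Gamma (A ⋀ B)
| nd_and_eliml Gamma A B : nd X Gamma (A ⋀ B) -> nd X Gamma A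
| nd_and_elimr Gamma A B : nd X Gamma (A ⋀ B) -> nd X Gamma B
| nd_all_intro Gamma r A :
    nd X (map (lift r) Gamma) A -> nd X Gamma (All r A)
| nd_all_elim Gamma r A (t : term r) :
    nd X Gamma (All r A) -> nd X Gamma (sub (inst t) A)
| nd_conv Gamma A B : nd X Gamma A -> fconv A B -> nd X Gamma B.

Definition provable (X : system) (A : form) : Prop := nd X [] A.

(* The classes below are given inductively. Every clause refers to formulas
   with fewer logical symbols only, so the least solution of the clauses is
   their unique solution, and the clauses hold as equivalences. *)
Inductive classQ : form -> Prop :=
| Q_at t : classQ (At t)
| Q_imp A B : classQ A -> classQ B -> classQ (A ⊃ B)
| Q_and A B : classQ A -> classQ B -> classQ (A ⋀ B)
| Q_all A : classQ (sub (inst tt_tm) A) -> classQ (sub (inst ff_tm) A) ->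
    classQ (All Bool A).

Definition classQF (A : form) : Prop := is_form MA A /\ classQ (bot_sub Fa A).

Inductive definite : form -> Prop :=
| D_bot : definite Bot
| D_at t : definite (At t)
| D_imp_ID A B : irrelevant A -> definite B -> definite (A ⊃ B)
| D_imp_GR A B : goal A -> relevant B -> definite (A ⊃ B)
| D_and A B : definite A -> definite B -> definite (A ⋀ B)
| D_all_D r A : definite A -> definite (All r A)
| D_all_R r A : relevant A -> definite (All r A)

with goal : form -> Prop :=
| G_bot : goal Bot
| G_at t : goal (At t)
| G_imp_RG A B : relevant A -> goal B -> goal (A ⊃ B)
| G_imp_QG A B : definite A -> classQF A -> goal B -> goal (A ⊃ B)
| G_imp_DI A B : definite A -> irrelevant B -> goal (A ⊃ B)
| G_and A B : goal A -> goal B -> goal (A ⋀ B)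
| G_all_I r A : irrelevant A -> goal (All r A)
| G_all_bool A : goal (sub (inst tt_tm) A) -> goal (sub (inst ff_tm) A) ->
    goal (All Bool A)

with relevant : form -> Prop :=
| R_bot : relevant Bot
| R_true : relevant Tr
| R_imp A B : goal A -> relevant B -> relevant (A ⊃ B)
| R_and A B : relevant A -> relevant B -> relevant (A ⋀ B)
| R_all r A : relevant A -> relevant (All r A)

with irrelevant : form -> Prop :=
| I_at t : irrelevant (At t)
| I_imp A B : definite A -> irrelevant B -> irrelevant (A ⊃ B)
| I_and A B : irrelevant A -> irrelevant B -> irrelevant (A ⋀ B)
| I_all r A : irrelevant A -> irrelevant (All r A).

(* Main.v *)
Require Import Defs.
From Stdlib Require Import List.
Import ListNotations.

(** The substitution [⊥ ↦ S] maps derivations of MA to derivations of HA. For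
    every S, simultaneous induction over the four classes shows that HA proves
    [D^F → D^S], [G^S → (G^F → S) → S], [(¬R^F → S) → R^S] and [I^S → I^F]; the
    only use of decidability is for premises in Q_F of goal formulas. With
    [S := ∃x G^F] the hypothesis becomes [D^S → ∀x (G^S → S) → S], whose first
    premise follows from [D^F], and whose second one follows from
    [G^F → ∃x G^F]. *)

Set Implicit Arguments.
Unset Strict Implicit.
Unset Printing Implicit Defensive.

(** * Renamings and substitutions *)

Ltac case_var :=
  repeat (unfold up_ren, up_sub, shift, inst, repl;
          match goal with
          | |- context [ty_eq_dec ?r ?t] => destruct (ty_eq_dec r t); subst
          | |- context [match ?n with 0 => _ | S _ => _ end] => is_var n; destruct n
          end; simpl); try congruence.

(** Renamings and substitutions are functions; comparing them pointwise avoids functional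
    extensionality. *)
Lemma up_ren_ext (r : ty) (f g : renaming) :
  (forall t n, f t n = g t n) -> forall t n, up_ren r f t n = up_ren r g t n.
Proof. intros H t n; case_var; auto. Qed.

Lemma up_sub_ext (r : ty) (s u : substitution) :
  (forall t n, s t n = u t n) -> forall t n, up_sub r s t n = up_sub r u t n.
Proof.
  intros H t n; unfold up_sub.
  destruct (ty_eq_dec r t); [destruct n|]; rewrite ?H; reflexivity.
Qed.

Lemma ren_tm_ext (t : ty) (u : term t) (f g : renaming) :
  (forall t n, f t n = g t n) -> ren_tm f u = ren_tm g u.
Proof.
  revert f g; induction u; simpl; intros f g H; f_equal; auto using up_ren_ext.
Qed.

Lemma ren_ext (A : form) (f g : renaming) :
  (forall t n, f t n = g t n) -> ren f A = ren g A.
Proof.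
  revert f g; induction A; simpl; intros f g H; f_equal;
    auto using up_ren_ext, ren_tm_ext.
Qed.

Lemma sub_tm_ext (t : ty) (u : term t) (s s' : substitution) :
  (forall t n, s t n = s' t n) -> sub_tm s u = sub_tm s' u.
Proof.
  revert s s'; induction u; simpl; intros s s' H; f_equal; auto using up_sub_ext.
Qed.

Lemma sub_ext (A : form) (s s' : substitution) :
  (forall t n, s t n = s' t n) -> sub s A = sub s' A.
Proof.
  revert s s'; induction A; simpl; intros s s' H; f_equal;
    auto using up_sub_ext, sub_tm_ext.
Qed.

Lemma ren_ren_tm (t : ty) (u : term t) (f g : renaming) :
  ren_tm f (ren_tm g u) = ren_tm (fun t n => f t (g t n)) u.
Proof.
  revert f g; induction u; simpl; intros f g; f_equal; auto.
  rewrite IHu; apply ren_tm_ext; intros t' n; case_var.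
Qed.

Lemma ren_ren (A : form) (f g : renaming) :
  ren f (ren g A) = ren (fun t n => f t (g t n)) A.
Proof.
  revert f g; induction A; simpl; intros f g; f_equal; auto using ren_ren_tm;
    rewrite IHA; apply ren_ext; intros t' n; case_var.
Qed.

Lemma sub_ren_tm (t : ty) (u : term t) (s : substitution) (f : renaming) :
  sub_tm s (ren_tm f u) = sub_tm (fun t n => s t (f t n)) u.
Proof.
  revert s f; induction u; simpl; intros s f; f_equal; auto.
  rewrite IHu; apply sub_tm_ext; intros t' n; case_var.
Qed.

Lemma sub_ren (A : form) (s : substitution) (f : renaming) :
  sub s (ren f A) = sub (fun t n => s t (f t n)) A.
Proof.
  revert s f; induction A; simpl; intros s f; f_equal; auto using sub_ren_tm;
    rewrite IHA; apply sub_ext; intros t' n; case_var.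
Qed.

Lemma ren_up_shift_tm (r t : ty) (u : term t) (f : renaming) :
  ren_tm (up_ren r f) (ren_tm (shift r) u) = ren_tm (shift r) (ren_tm f u).
Proof. rewrite !ren_ren_tm; apply ren_tm_ext; intros t' n; case_var. Qed.

Lemma ren_up_sub (r : ty) (f : renaming) (s : substitution) (t : ty) (n : nat) :
  ren_tm (up_ren r f) (up_sub r s t n)
  = up_sub r (fun t n => ren_tm f (s t n)) t n.
Proof.
  unfold up_sub; destruct (ty_eq_dec r t); [destruct n|];
    rewrite ?ren_up_shift_tm; try reflexivity; simpl; f_equal; case_var.
Qed.

Lemma ren_sub_tm (t : ty) (u : term t) (f : renaming) (s : substitution) :
  ren_tm f (sub_tm s u) = sub_tm (fun t n => ren_tm f (s t n)) u.
Proof.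
  revert s f; induction u; simpl; intros s f; f_equal; auto.
  rewrite IHu; apply sub_tm_ext, ren_up_sub.
Qed.

Lemma ren_sub (A : form) (f : renaming) (s : substitution) :
  ren f (sub s A) = sub (fun t n => ren_tm f (s t n)) A.
Proof.
  revert s f; induction A; simpl; intros s f; f_equal; auto using ren_sub_tm;
    rewrite IHA; apply sub_ext, ren_up_sub.
Qed.

Lemma up_sub_Var (r t : ty) (n : nat) : up_sub r Var t n = Var t n.
Proof.
  unfold up_sub; destruct (ty_eq_dec r t); [destruct n|]; simpl;
    try reflexivity; f_equal; case_var.
Qed.

Lemma sub_tm_id (t : ty) (u : term t) (s : substitution) :
  (forall t n, s t n = Var t n) -> sub_tm s u = u.
Proof.
  revert s; induction u; simpl; intros s H; f_equal; auto.
  apply IHu; intros; rewrite (up_sub_ext _ H); apply up_sub_Var.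
Qed.

Lemma sub_id (A : form) (s : substitution) :
  (forall t n, s t n = Var t n) -> sub s A = A.
Proof.
  revert s; induction A; simpl; intros s H; f_equal; auto using sub_tm_id;
    apply IHA; intros; rewrite (up_sub_ext _ H); apply up_sub_Var.
Qed.

Lemma sub_ren_id (A : form) (s : substitution) (f : renaming) :
  (forall t n, s t (f t n) = Var t n) -> sub s (ren f A) = A.
Proof. intros H; rewrite sub_ren; apply sub_id, H. Qed.

Lemma lift_ren (r : ty) (A : form) (f : renaming) :
  lift r (ren f A) = ren (up_ren r f) (lift r A).
Proof. unfold lift; rewrite !ren_ren; apply ren_ext; intros t n; case_var. Qed.

Lemma lift_sub (r : ty) (A : form) (s : substitution) :
  lift r (sub s A) = sub (up_sub r s) (lift r A).
Proof.
  unfold lift; rewrite ren_sub, sub_ren; apply sub_ext; intros t n.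
  unfold up_sub, shift; destruct (ty_eq_dec r t); reflexivity.
Qed.

Lemma sub_inst_lift (r : ty) (v : term r) (A : form) :
  sub (inst v) (lift r A) = A.
Proof. apply sub_ren_id; intros t n; case_var. Qed.

(** [repl v] changes only the index 0 of type [r], which does not occur after a lift. *)
Lemma sub_repl_lift (r : ty) (v : term r) (A : form) :
  sub (repl v) (lift r A) = lift r A.
Proof.
  rewrite <- (sub_id (lift r A) (s := Var)) at 2 by reflexivity.
  unfold lift; rewrite !sub_ren; apply sub_ext; intros t n; case_var.
Qed.

(** The renaming skips just index 1 of type [r], and instantiating index 0 by itself closes this
    gap. Hence eliminating a lifted quantifier at the fresh variable restores its body. *)
Lemma sub_inst_up_shift (r : ty) (A : form) :
  sub (inst (Var r 0)) (ren (up_ren r (shift r)) A) = A.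
Proof. apply sub_ren_id; intros t n; case_var. Qed.

(** * Replacing [Bot] *)

(** The inserted copies of [S] are renamed as well, so [S] has to be renamed along; the binder case
    is [lift_ren]. *)
Lemma bot_sub_ren (A S : form) (f : renaming) :
  bot_sub (ren f S) (ren f A) = ren f (bot_sub S A).
Proof.
  revert S f; induction A; simpl; intros S f; f_equal; auto;
    rewrite lift_ren; apply IHA.
Qed.

Lemma bot_sub_sub (A S : form) (s : substitution) :
  bot_sub (sub s S) (sub s A) = sub s (bot_sub S A).
Proof.
  revert S s; induction A; simpl; intros S s; f_equal; auto;
    rewrite lift_sub; apply IHA.
Qed.

Lemma bot_sub_lift (r : ty) (A S : form) :
  bot_sub (lift r S) (lift r A) = lift r (bot_sub S A).
Proof. apply bot_sub_ren. Qed.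

(** Serves the formula [Al] of the list induction axiom, which sits under two binders. *)
Lemma bot_sub_up_ren (q r : ty) (A S : form) :
  bot_sub (lift q (lift r S)) (ren (up_ren q (shift r)) A)
  = ren (up_ren q (shift r)) (bot_sub (lift q S) A).
Proof.
  change (lift r S) with (ren (shift r) S); rewrite lift_ren; apply bot_sub_ren.
Qed.

(** The instantiated variable does not occur in [lift r S], so the inserted copies turn back into
    [S]. *)
Lemma bot_sub_inst (r : ty) (v : term r) (A S : form) :
  bot_sub S (sub (inst v) A) = sub (inst v) (bot_sub (lift r S) A).
Proof. rewrite <- bot_sub_sub, sub_inst_lift; reflexivity. Qed.

Lemma bot_sub_repl (r : ty) (v : term r) (A S : form) :
  bot_sub (lift r S) (sub (repl v) A) = sub (repl v) (bot_sub (lift r S) A).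
Proof. rewrite <- bot_sub_sub, sub_repl_lift; reflexivity. Qed.

Lemma fconv_refl (A : form) : fconv A A.
Proof. induction A; constructor; auto; apply conv_refl. Qed.

Lemma bot_sub_fconv (S A B : form) :
  fconv A B -> fconv (bot_sub S A) (bot_sub S B).
Proof.
  intros H; revert S; induction H; simpl; intros S; try constructor; auto.
  apply fconv_refl.
Qed.

(** * Well-formedness of formulas and derivations *)

Lemma is_form_ren (X : system) (A : form) (f : renaming) :
  is_form X (ren f A) <-> is_form X A.
Proof.
  revert f; induction A; simpl; intros f;
    rewrite ?IHA, ?IHA1, ?IHA2; reflexivity.
Qed.

Lemma is_form_sub (X : system) (A : form) (s : substitution) :
  is_form X (sub s A) <-> is_form X A.
Proof.
  revert s; induction A; simpl; intros s;
    rewrite ?IHA, ?IHA1, ?IHA2; reflexivity.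
Qed.

Lemma is_form_lift (X : system) (r : ty) (A : form) :
  is_form X (lift r A) <-> is_form X A.
Proof. apply is_form_ren. Qed.

Lemma is_form_bot_sub (S A : form) :
  is_form HA S -> is_form MA A -> is_form HA (bot_sub S A).
Proof.
  revert S; induction A; simpl; intros S hS hA; intuition;
    try (apply IHA; rewrite ?is_form_lift; assumption); congruence.
Qed.

Lemma is_form_fconv (X : system) (A B : form) :
  fconv A B -> is_form X A -> is_form X B.
Proof. induction 1; simpl; tauto. Qed.

Lemma is_form_axiom (X : system) (A : form) : axiom X A -> is_form X A.
Proof.
  destruct 1; simpl; rewrite ?is_form_lift, ?is_form_sub, ?is_form_ren;
    try subst Al; simpl; rewrite ?is_form_sub, ?is_form_ren; tauto.
Qed.

(** The formation premises of assumptions, axioms and [nd_imp_intro] propagate through all rules;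
    this supplies side conditions of later derivations. *)
Lemma is_form_nd (X : system) (Gamma : list form) (A : form) :
  nd X Gamma A -> is_form X A.
Proof.
  induction 1; simpl in *; rewrite ?is_form_sub;
    try tauto; eauto using is_form_axiom, is_form_fconv.
Qed.

(* Induction runs over class membership rather than over formulas, because the boolean clause of
   [goal] refers to instances, which are not subformulas. *)
Scheme definite_mind := Minimality for definite Sort Prop
with goal_mind := Minimality for goal Sort Prop
with relevant_mind := Minimality for relevant Sort Prop
with irrelevant_mind := Minimality for irrelevant Sort Prop.
Combined Scheme class_mind from
  definite_mind, goal_mind, relevant_mind, irrelevant_mind.

Lemma is_form_class :
  (forall A, definite A -> is_form MA A) /\ (forall A, goal A -> is_form MA A) /\
  (forall A, relevant A -> is_form MA A) /\
  (forall A, irrelevant A -> is_form MA A).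
Proof.
  apply class_mind; simpl; intros; rewrite ?is_form_sub in *; auto.
Qed.

Lemma is_form_classQ (A : form) : classQ A -> is_form HA A.
Proof. induction 1; simpl in *; rewrite ?is_form_sub in *; auto. Qed.

(** * Derived rules *)

Lemma nd_weak (X : system) (Gamma Delta : list form) (A : form) :
  incl Gamma Delta -> nd X Gamma A -> nd X Delta A.
Proof.
  intros H K; revert Delta H; induction K; intros Delta HD.
  - apply nd_assume; auto.
  - apply nd_axiom; auto.
  - apply nd_imp_intro; auto. apply IHK.
    intros B' [<-|H']; [left|right]; auto.
  - eapply nd_imp_elim; eauto.
  - apply nd_and_intro; auto.
  - eapply nd_and_eliml; eauto.
  - eapply nd_and_elimr; eauto.
  - apply nd_all_intro, IHK, incl_map, HD.
  - apply nd_all_elim; auto.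
  - eapply nd_conv; eauto.
Qed.

Lemma nd_cons (X : system) (Gamma : list form) (A B : form) :
  nd X Gamma B -> nd X (A :: Gamma) B.
Proof. apply nd_weak, incl_tl, incl_refl. Qed.

Lemma nd_hd (X : system) (Gamma : list form) (A : form) :
  is_form X A -> nd X (A :: Gamma) A.
Proof. intros H; apply nd_assume; [exact H | left; reflexivity]. Qed.

Lemma nd_cut (X : system) (Gamma : list form) (A B : form) :
  nd X Gamma A -> nd X (A :: Gamma) B -> nd X Gamma B.
Proof.
  intros H K; apply (nd_imp_elim (A := A)); [|exact H].
  apply nd_imp_intro; [exact (is_form_nd H) | exact K].
Qed.

Lemma nd_all_var (X : system) (Gamma : list form) (r : ty) (A : form) :
  nd X Gamma (lift r (All r A)) -> nd X Gamma A.
Proof.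
  intros H; apply (nd_all_elim (Var r 0)) in H.
  rewrite sub_inst_up_shift in H; exact H.
Qed.

(* Cutting on the premise spares the closure of derivations under renaming. *)
Lemma nd_all_map (X : system) (Gamma : list form) (r : ty) (A B : form) :
  (forall Delta, nd X Delta A -> nd X Delta B) ->
  nd X Gamma (All r A) -> nd X Gamma (All r B).
Proof.
  intros H K; apply (nd_cut K), nd_all_intro, H, (nd_all_var (r := r)), nd_hd.
  rewrite is_form_lift; exact (is_form_nd K).
Qed.

Lemma nd_all_bool (X : system) (Gamma : list form) (A : form) :
  nd X Gamma (sub (inst tt_tm) A) -> nd X Gamma (sub (inst ff_tm) A) ->
  nd X Gamma (All Bool A).
Proof.
  intros Ht Hf.
  pose proof (is_form_nd Ht) as hA; rewrite is_form_sub in hA.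
  (* Both instances and the axiom become assumptions first, so that [nd_all_intro] lifts them in the
     context and no derivation has to be renamed. *)
  apply (nd_cut Ht), (nd_cut (nd_cons _ Hf)).
  apply (nd_cut (nd_axiom _ (ax_bool hA))), nd_all_intro; simpl map.
  eapply nd_imp_elim; [eapply nd_imp_elim; [apply (nd_all_var (r := Bool)), nd_hd|]|].
  - rewrite is_form_lift; exact (is_form_axiom (ax_bool hA)).
  - apply nd_assume; [rewrite is_form_lift, is_form_sub; exact hA | simpl; auto].
  - apply nd_assume; [rewrite is_form_lift, is_form_sub; exact hA | simpl; auto].
Qed.

(** Boolean cases on [b] in [Fa ⊃ At b]: for [tt] the conclusion is an axiom, for [ff] it is the
    premise. *)
Lemma nd_efq_at (X : system) (Gamma : list form) (t : term Bool) :
  nd X Gamma Fa -> nd X Gamma (At t).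
Proof.
  intros H; apply (nd_imp_elim (A := Fa)); [|exact H].
  apply (nd_all_elim (A := Fa ⊃ At (Var Bool 0)) t).
  apply nd_all_bool; apply nd_imp_intro; simpl; auto.
  - apply nd_axiom, ax_true.
  - apply nd_hd; exact I.
Qed.

Lemma nd_efq (Gamma : list form) (A : form) :
  is_form HA A -> nd HA Gamma Fa -> nd HA Gamma A.
Proof.
  revert Gamma; induction A; simpl; intros Gamma hA H.
  - apply nd_efq_at, H.
  - congruence.
  - apply nd_imp_intro, IHA2, nd_cons, H; tauto.
  - apply nd_and_intro; [apply IHA1 | apply IHA2]; tauto.
  - apply (nd_imp_elim (A := A1)); [apply nd_axiom, ax_or_introl | apply IHA1];
      tauto.
  - apply (nd_cut H), nd_all_intro, IHA, nd_hd; [exact hA | exact I].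
  (* The induction hypothesis concerns the body [A] and not its instances, so an instance is reached
     through the universal closure. *)
  - assert (K : nd HA Gamma (All t A)).
    { apply (nd_cut H), nd_all_intro, IHA, nd_hd; [tauto | exact I]. }
    (* A variable serves as witness, since it inhabits any type. *)
    apply (nd_imp_elim (A := sub (inst (Var t 0)) A)).
    + apply nd_axiom, ax_ex_intro; tauto.
    + apply nd_all_elim, K.
Qed.

Lemma nd_orl (Gamma : list form) (A B : form) :
  is_form HA B -> nd HA Gamma A -> nd HA Gamma (A ⋁ B).
Proof.
  intros hB H; apply (nd_imp_elim (A := A)); [|exact H].
  apply nd_axiom, ax_or_introl; [exact (is_form_nd H) | exact hB].
Qed.

Lemma nd_orr (Gamma : list form) (A B : form) :
  is_form HA A -> nd HA Gamma B -> nd HA Gamma (A ⋁ B).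
Proof.
  intros hA H; apply (nd_imp_elim (A := B)); [|exact H].
  apply nd_axiom, ax_or_intror; [exact hA | exact (is_form_nd H)].
Qed.

Lemma nd_or_elim (Gamma : list form) (A B C : form) :
  nd HA Gamma (A ⋁ B) -> nd HA (A :: Gamma) C -> nd HA (B :: Gamma) C ->
  nd HA Gamma C.
Proof.
  intros H HA' HB'; pose proof (is_form_nd H) as [_ [hA hB]].
  apply (nd_imp_elim (A := B ⊃ C)); [|apply nd_imp_intro; auto].
  apply (nd_imp_elim (A := A ⊃ C)); [|apply nd_imp_intro; auto].
  apply (nd_imp_elim (A := A ⋁ B)); [|exact H].
  apply nd_axiom, ax_or_elim; auto; exact (is_form_nd HA').
Qed.

Ltac assm :=
  first [ eassumption
        | apply nd_hd; simpl; tauto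
        | apply nd_cons; assm ].

(** * Decidability of the formulas in Q *)

Lemma nd_dec_at (Gamma : list form) (t : term Bool) :
  nd HA Gamma (At t ⋁ Neg (At t)).
Proof.
  apply (nd_all_elim (A := At (Var Bool 0) ⋁ Neg (At (Var Bool 0))) t).
  apply nd_all_bool; simpl.
  - apply nd_orl; [simpl; auto|]. apply nd_axiom, ax_true.
  - apply nd_orr; [simpl; auto|]. apply nd_imp_intro; [exact I | assm].
Qed.

(** Implication and conjunction preserve decidability, and a quantifier over booleans behaves like
    the conjunction of its two instances. *)
Lemma nd_dec_classQ (A : form) :
  classQ A -> forall Gamma, nd HA Gamma (A ⋁ Neg A).
Proof.
  induction 1 as [t | A B QA IHA QB IHB | A B QA IHA QB IHB | A Qt IHt Qf IHf];
    intros Gamma.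
  - apply nd_dec_at.
  - pose proof (is_form_classQ QA); pose proof (is_form_classQ QB).
    apply (nd_or_elim (IHB Gamma)).
    { apply nd_orl; [simpl; tauto|]. apply nd_imp_intro; [tauto | assm]. }
    apply (nd_or_elim (IHA _)).
    + apply nd_orr; [simpl; tauto|]. apply nd_imp_intro; [simpl; tauto|].
      apply (nd_imp_elim (A := B)); [assm|]. apply (nd_imp_elim (A := A)); assm.
    + apply nd_orl; [simpl; tauto|]. apply nd_imp_intro; [tauto|].
      apply nd_efq; [tauto|]. apply (nd_imp_elim (A := A)); assm.
  - pose proof (is_form_classQ QA); pose proof (is_form_classQ QB).
    apply (nd_or_elim (IHA Gamma)).
    2:{ apply nd_orr; [simpl; tauto|]. apply nd_imp_intro; [simpl; tauto|].
        apply (nd_imp_elim (A := A)); [assm|].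
        apply nd_and_eliml with B; assm. }
    apply (nd_or_elim (IHB _)).
    + apply nd_orl; [simpl; tauto|]. apply nd_and_intro; assm.
    + apply nd_orr; [simpl; tauto|]. apply nd_imp_intro; [simpl; tauto|].
      apply (nd_imp_elim (A := B)); [assm|].
      apply nd_and_elimr with A; assm.
  - pose proof (is_form_classQ Qt) as hA; pose proof (is_form_classQ Qf).
    rewrite is_form_sub in hA.
    apply (nd_or_elim (IHt Gamma)).
    2:{ apply nd_orr; [simpl; tauto|]. apply nd_imp_intro; [simpl; tauto|].
        apply (nd_imp_elim (A := sub (inst tt_tm) A)).
        - apply nd_cons, nd_hd; simpl; rewrite is_form_sub; tauto.
        - apply nd_all_elim; assm. }
    apply (nd_or_elim (IHf _)).
    + apply nd_orl; [simpl; tauto|]. apply nd_all_bool; [|assm].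
      apply nd_cons, nd_hd; rewrite is_form_sub; tauto.
    + apply nd_orr; [simpl; tauto|]. apply nd_imp_intro; [simpl; tauto|].
      apply (nd_imp_elim (A := sub (inst ff_tm) A)); [assm|].
      apply nd_all_elim; assm.
Qed.

(** * The translation of derivations *)

(** Each common axiom becomes an instance of the same scheme, as the replacement commutes with the
    substitutions in it; [Fa ⊃ Bot] becomes ex falso for [S]. *)
Lemma bot_sub_axiom (Gamma : list form) (S A : form) :
  is_form HA S -> axiom MA A -> nd HA Gamma (bot_sub S A).
Proof.
  intros hS H.
  assert (hform : forall r B, is_form MA B ->
            is_form HA (bot_sub (lift r S) B)).
  { intros r B hB; apply is_form_bot_sub; [rewrite is_form_lift|]; assumption. }
  inversion H as [|X B hB|X B hB|X r B hB Al| | | | | |]; subst; cbn [bot_sub].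
  - apply nd_axiom, ax_true.
  - rewrite !bot_sub_lift, !bot_sub_inst; apply nd_axiom, ax_bool; auto.
  - rewrite !bot_sub_lift; cbn [bot_sub].
    rewrite bot_sub_inst, bot_sub_repl; apply nd_axiom, ax_nat; auto.
  - subst Al; rewrite !bot_sub_lift; cbn [bot_sub].
    rewrite bot_sub_inst, bot_sub_repl, !bot_sub_up_ren.
    apply nd_axiom, ax_list; auto.
  - apply nd_imp_intro; [exact I|]; apply nd_efq; [exact hS | assm].
Qed.

(** The replacement acts rule by rule. The induction is over all [S], because ∀-introduction passes
    to [lift r S]. *)
Lemma bot_sub_nd (Gamma : list form) (S A : form) :
  is_form HA S -> nd MA Gamma A ->
  nd HA (map (bot_sub S) Gamma) (bot_sub S A).
Proof.
  intros hS H; remember MA as X eqn:hX; revert S hS.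
  induction H; subst; intros S hS; cbn [bot_sub] in *.
  - apply nd_assume; [apply is_form_bot_sub; assumption | apply in_map; assumption].
  - apply bot_sub_axiom; assumption.
  - apply nd_imp_intro; [apply is_form_bot_sub; assumption | apply IHnd; auto].
  - eapply nd_imp_elim; [apply IHnd1 | apply IHnd2]; auto.
  - apply nd_and_intro; auto.
  - eapply nd_and_eliml; apply IHnd; auto.
  - eapply nd_and_elimr; apply IHnd; auto.
  - apply nd_all_intro.
    rewrite map_map, <- (map_ext _ _ (fun B => bot_sub_lift r B S)), <- map_map.
    apply IHnd; rewrite ?is_form_lift; auto.
  - rewrite bot_sub_inst; apply nd_all_elim, IHnd; auto.
  - eapply nd_conv; [apply IHnd; auto | apply bot_sub_fconv; assumption].
Qed.

(** * The four classes *)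

(** Stating the claims as rules over arbitrary contexts fits [nd_all_map]; [S] varies because
    quantifiers lift it, while [lift r Fa] reduces to [Fa]. The claim for goals is in continuation
    style, so [S] plays the role of falsity. *)
Lemma nd_bot_sub_class :
  (forall A, definite A -> forall Gamma S, is_form HA S ->
     nd HA Gamma (bot_sub Fa A) -> nd HA Gamma (bot_sub S A)) /\
  (forall A, goal A -> forall Gamma S, is_form HA S ->
     nd HA Gamma (bot_sub S A) -> nd HA Gamma (bot_sub Fa A ⊃ S) ->
     nd HA Gamma S) /\
  (forall A, relevant A -> forall Gamma S, is_form HA S ->
     nd HA Gamma (Neg (bot_sub Fa A) ⊃ S) -> nd HA Gamma (bot_sub S A)) /\
  (forall A, irrelevant A -> forall Gamma S, is_form HA S ->
     nd HA Gamma (bot_sub S A) -> nd HA Gamma (bot_sub Fa A)).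
Proof.
  destruct is_form_class as [fD [fG [fR fI]]].
  assert (hform : forall A S, is_form HA S -> is_form MA A ->
            is_form HA (bot_sub S A)) by (intros; apply is_form_bot_sub; assumption).
  assert (hF : is_form HA Fa) by exact I.
  apply class_mind; cbn [bot_sub].
  - intros Gamma S hS H; apply nd_efq; assumption.
  - auto.
  - intros A B hA IHA hB IHB Gamma S hS H.
    apply nd_imp_intro; [auto|]; apply IHB; [assumption|].
    apply (nd_imp_elim (A := bot_sub Fa A)); [assm|].
    apply IHA with S; [assumption|]; apply nd_hd; auto.
  (* Goal to relevant: given [A^S] and [¬B^F], the goal claim leaves [A^F → S]; [A^F] yields [B^F],
     a contradiction. *)
  - intros A B hA IHA hB IHB Gamma S hS H.
    apply nd_imp_intro; [auto|]; apply IHB; [assumption|].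
    apply nd_imp_intro; [simpl; auto|].
    apply IHA; [assumption | apply nd_cons, nd_hd; auto |].
    apply nd_imp_intro; [auto|].
    apply nd_efq; [assumption|].
    apply (nd_imp_elim (A := bot_sub Fa B)); [apply nd_cons, nd_hd; simpl; auto|].
    apply (nd_imp_elim (A := bot_sub Fa A)); [assm | apply nd_hd; auto].
  - intros A B hA IHA hB IHB Gamma S hS H.
    apply nd_and_intro; [apply IHA | apply IHB]; try assumption.
    + eapply nd_and_eliml; eassumption.
    + eapply nd_and_elimr; eassumption.
  - intros r A hA IHA Gamma S hS.
    apply nd_all_map; intros Delta; apply IHA; rewrite is_form_lift; assumption.
  (* Relevant body: [A^F] makes [¬A^F → S] an instance of ex falso. *)
  - intros r A hA IHA Gamma S hS.
    apply nd_all_map; intros Delta H; apply IHA; [rewrite is_form_lift; assumption|].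
    apply nd_imp_intro; [simpl; auto|].
    apply nd_efq; [rewrite is_form_lift; assumption|].
    eapply nd_imp_elim; [apply nd_hd; simpl; auto | assm].
  - intros Gamma S hS H K; assumption.
  - intros t Gamma S hS H K; eapply nd_imp_elim; eassumption.
  (* Relevant to goal: [¬A^F] makes [A^F → B^F] vacuous, so [K] gives [S]; this is what the relevant
     claim asks for to obtain [A^S]. *)
  - intros A B hA IHA hB IHB Gamma S hS H K.
    apply IHB; [assumption | |].
    + apply (nd_imp_elim H), IHA; [assumption|].
      apply nd_imp_intro; [simpl; auto|].
      eapply nd_imp_elim; [apply nd_cons; eassumption|].
      apply nd_imp_intro; [auto|]. apply nd_efq; [auto|].
      eapply nd_imp_elim; [apply nd_cons, nd_hd; simpl; auto | apply nd_hd; auto].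
    + apply nd_imp_intro; [auto|].
      eapply nd_imp_elim; [apply nd_cons; eassumption|].
      apply nd_imp_intro; [auto|]. apply nd_cons, nd_hd; auto.
  - intros A B hA IHA [_ hQ] hB IHB Gamma S hS H K.
    (* If [A^F] holds, the definite claim gives [A^S]; otherwise [A^F → B^F] is vacuous and [K]
       applies. *)
    apply (nd_or_elim (nd_dec_classQ hQ Gamma)).
    + apply IHB; [assumption | |].
      * apply (nd_imp_elim (nd_cons _ H)), IHA; [assumption|]. apply nd_hd; auto.
      * apply nd_imp_intro; [auto|].
        eapply nd_imp_elim; [apply nd_cons, nd_cons; eassumption|].
        apply nd_imp_intro; [auto|]. apply nd_cons, nd_hd; auto.
    + apply (nd_imp_elim (nd_cons _ K)).
      apply nd_imp_intro; [auto|]. apply nd_efq; [auto|].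
      eapply nd_imp_elim; [apply nd_cons, nd_hd; simpl; auto | apply nd_hd; auto].
  (* Definite to irrelevant: [A^F → B^F] is derived outright through [A^S] and [B^S], then passed to
     [K]. *)
  - intros A B hA IHA hB IHB Gamma S hS H K.
    apply (nd_imp_elim K), nd_imp_intro; [auto|]. apply IHB with S; [assumption|].
    apply (nd_imp_elim (nd_cons _ H)), IHA; [assumption | apply nd_hd; auto].
  - intros A B hA IHA hB IHB Gamma S hS H K.
    apply IHA; [assumption | eapply nd_and_eliml; eassumption |].
    apply nd_imp_intro; [auto|].
    apply IHB; [assumption | eapply nd_and_elimr, nd_cons; eassumption |].
    apply nd_imp_intro; [auto|].
    apply (nd_imp_elim (nd_cons _ (nd_cons _ K))), nd_and_intro;
      [apply nd_cons|]; apply nd_hd; auto.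
  - intros r A hA IHA Gamma S hS H K.
    apply (nd_imp_elim K); revert H; apply nd_all_map; intros Delta.
    apply IHA; rewrite is_form_lift; assumption.
  (* The claims for the two instances are nested as for a conjunction, until both are available to
     rebuild the quantifier. *)
  - intros A ht IHt hf IHf Gamma S hS H K.
    apply IHt; [assumption | rewrite bot_sub_inst; apply nd_all_elim, H |].
    apply nd_imp_intro; [auto|].
    apply IHf; [assumption | apply nd_cons; rewrite bot_sub_inst; apply nd_all_elim, H |].
    apply nd_imp_intro; [auto|].
    apply (nd_imp_elim (nd_cons _ (nd_cons _ K))).
    apply nd_all_bool; rewrite <- bot_sub_inst; [apply nd_cons|]; apply nd_hd; auto.
  (* Here [⊥^F] is [Fa], whose negation is provable. *)
  - intros Gamma S hS H; apply (nd_imp_elim H).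
    apply nd_imp_intro; [exact I | assm].
  - intros Gamma S hS H; apply nd_axiom, ax_true.
  (* Under [A^S], [¬B^F] and [A^F], the implication [A^F → B^F] is refuted, so [H] yields [S]. *)
  - intros A B hA IHA hB IHB Gamma S hS H.
    apply nd_imp_intro; [auto|]; apply IHB; [assumption|].
    apply nd_imp_intro; [simpl; auto|].
    apply IHA; [assumption | apply nd_cons, nd_hd; auto |].
    apply nd_imp_intro; [auto|].
    apply (nd_imp_elim (nd_cons _ (nd_cons _ (nd_cons _ H)))).
    apply nd_imp_intro; [simpl; auto|].
    apply (nd_imp_elim (A := bot_sub Fa B));
      [apply nd_cons, nd_cons, nd_hd; simpl; auto|].
    apply (nd_imp_elim (A := bot_sub Fa A)); [|apply nd_cons]; apply nd_hd; simpl; auto.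
  - intros A B hA IHA hB IHB Gamma S hS H.
    apply nd_and_intro; [apply IHA | apply IHB]; try assumption;
      apply nd_imp_intro; simpl; auto; apply (nd_imp_elim (nd_cons _ H));
      apply nd_imp_intro; simpl; auto; eapply nd_imp_elim;
      [ apply nd_cons, nd_hd; simpl; auto
      | eapply nd_and_eliml, nd_hd; simpl; auto
      | apply nd_cons, nd_hd; simpl; auto
      | eapply nd_and_elimr, nd_hd; simpl; auto ].
  - intros r A hA IHA Gamma S hS H.
    (* With [H] lifted as an assumption, [¬A^F] at the fresh variable refutes the lifted [∀A^F]. *)
    apply (nd_cut H), nd_all_intro, IHA; [rewrite is_form_lift; assumption|].
    apply nd_imp_intro; [simpl; auto|].
    eapply nd_imp_elim.
    { apply nd_cons, nd_hd; exact (proj2 (is_form_lift _ r _) (is_form_nd H)). }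
    apply nd_imp_intro; [simpl; rewrite is_form_ren; auto|].
    eapply nd_imp_elim; [apply nd_cons, nd_hd; simpl; auto|].
    apply (nd_all_var (r := r)), nd_hd; rewrite is_form_lift; simpl; auto.
  - auto.
  - intros A B hA IHA hB IHB Gamma S hS H.
    apply nd_imp_intro; [auto|]; apply IHB with S; [assumption|].
    apply (nd_imp_elim (nd_cons _ H)), IHA; [assumption | apply nd_hd; auto].
  - intros A B hA IHA hB IHB Gamma S hS H.
    apply nd_and_intro; [apply IHA with S | apply IHB with S]; try assumption.
    + eapply nd_and_eliml; eassumption.
    + eapply nd_and_elimr; eassumption.
  - intros r A hA IHA Gamma S hS.
    apply nd_all_map; intros Delta; apply IHA; rewrite is_form_lift; assumption.
Qed.

(** * Extraction of the existential conclusion *)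

Theorem corollary4p2 (D G : form) (r : ty) (hD : definite D) (hG : goal G)
  (hprov : provable MA (Imp D (Imp (All r (Imp G Bot)) Bot))) :
  provable HA (Imp (bot_sub Fa D) (Ex r (bot_sub Fa G))).
Proof.
  destruct is_form_class as [fD [fG _]], nd_bot_sub_class as [cD [cG _]].
  assert (hD' : is_form HA (bot_sub Fa D)).
  { apply is_form_bot_sub; [exact I | auto]. }
  assert (hG' : is_form HA (bot_sub Fa G)).
  { apply is_form_bot_sub; [exact I | auto]. }
  set (S := Ex r (bot_sub Fa G)).
  assert (hS : is_form HA S) by (simpl; auto).
  assert (hlS : is_form HA (lift r S)) by (rewrite is_form_lift; exact hS).
  pose proof (bot_sub_nd hS hprov) as H; cbn [bot_sub map] in H.
  apply nd_imp_intro; [exact hD'|].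
  eapply nd_imp_elim; [eapply nd_imp_elim; [apply nd_cons, H|]|].
  - apply cD; [auto | exact hS | apply nd_hd, hD'].
  - apply nd_all_intro, nd_imp_intro; [apply is_form_bot_sub; auto|].
    (* Under the quantifier the goal claim is used with [lift r S], leaving [G^F → lift r S]. *)
    apply (cG G hG); [exact hlS | apply nd_hd, is_form_bot_sub; auto |].
    apply nd_imp_intro; [exact hG'|].
    eapply nd_imp_elim.
    (* The witness is the quantified variable itself; the renaming describes the body of the lifted
       existential formula. *)
    + apply nd_axiom, (ax_ex_intro (A := ren (up_ren r (shift r)) (bot_sub Fa G))
                         (Var r 0)).
      rewrite is_form_ren; exact hG'.
    + rewrite sub_inst_up_shift; apply nd_hd, hG'.
Qed.
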